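(* Let $(\mathcal X,d)$ be a metric space and $F=\{f_1,\dots,f_r\}\subset C(\mathcal X,\mathcal X)$ with $r\ge2$. Assume that there exist nonempty sets $V_i\subset U_i\subset\mathcal X$ ($i=1,\dots,r$), points $a_1,\dots,a_r\in\mathcal X$ (not necessarily distinct), a point $q\in\mathcal X$, and constants $\Delta,\alpha>0$ such that, with $A:=\{a_1,\dots,a_r\}$ and $Q:=\{q\}\cup\bigcup_{j=1}^rV_j$: (1) $\mathrm{dist}(U_i,U_j)\ge\Delta$ for $i\ne j$; (2) $Q\subset f_i(V_i)$ for every $i$; (3) $f_i(\mathcal X\setminus U_i)=\{a_i\}$ and $f_i(A)\subset A$ for every $i$; (4) $\mathrm{dist}(\{q\},A)\ge\alpha$. Then, for every $k$ and every $0<\varepsilon<\alpha/2$, $$N\big(B(k,F),d_\infty,\varepsilon\big)\ge r^k .$$ Moreover, for each $k$ the map $u=i_k\cdots i_1\mapsto f_u:=f_{i_k}\circ\cdots\circ f_{i_1}$ is injective on words $u\in\{1,\dots,r\}^k$.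
   Context: $C(\mathcal X,\mathcal X)$ is the set of continuous self-maps; $d_\infty(f,g)=\sup_xd(f(x),g(x))$. $\mathrm{dist}(U,V)=\inf_{x\in U,y\in V}d(x,y)$. $B(k,F)$ is the set of all compositions of at most $k$ maps from $F$ (including the identity). $N(A,\rho,\varepsilon)$ is the covering number: the least number (possibly $\infty$) of open $\rho$-balls of radius $\varepsilon$, with centers in the ambient space $C(\mathcal X,\mathcal X)$, covering $A$. *)

(* Defs.v *)
From HB Require Import structures.
From mathcomp Require Import all_boot all_order all_algebra.
From mathcomp Require Import all_classical reals ereal topology.

Set Implicit Arguments.
Unset Strict Implicit.
Unset Printing Implicit Defensive.

Import Order.TTheory GRing.Theory Num.Theory.

Local Open Scope classical_set_scope.
Local Open Scope ring_scope.

Definition cont_maps (X : topologicalType) : set (X -> X) :=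
  [set g | continuous g].

(* Extended-real valued: the supremum may be infinite when X is unbounded. *)
Definition dsup (R : realType) (X : metricType R) (f g : X -> X) : \bar R :=
  ereal_sup [set (mdist (f x) (g x))%:E | x in [set: X]].

Definition set_dist (R : realType) (X : metricType R) (U V : set X) : \bar R :=
  ereal_inf [set (mdist z.1 z.2)%:E | z in U `*` V].

(* [:: h1; ...; hm] is sent to h1 \o ... \o hm, and [::] to the identity. *)
Definition comp_seq (T : Type) (s : seq (T -> T)) : T -> T :=
  foldr (fun h g => h \o g) idfun s.

Definition compositions (T : choiceType) (k : nat) (F : set (T -> T)) :
    set (T -> T) :=
  [set g | exists s : seq (T -> T),
     [/\ (size s <= k)%N, [set` s] `<=` F & g = comp_seq s]].

(* A word is listed as it is written, u = [tuple i_k; ...; i_1], so that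
   f_u = f i_k \o ... \o f i_1. *)
Definition word_map (T : Type) (r k : nat) (f : 'I_r -> T -> T)
    (u : k.-tuple 'I_r) : T -> T :=
  comp_seq [seq f i | i <- u].

(* The centers range over the ambient space E.  If no finite cover exists, the
   infimum is taken over the empty set and equals +oo. *)
Definition covering_number (R : realType) (T : Type) (E : set T)
    (rho : T -> T -> \bar R) (A : set T) (eps : R) : \bar R :=
  ereal_inf [set n%:R%:E | n in [set n : nat | exists c : 'I_n -> T,
    (forall i, E (c i)) /\
    A `<=` \bigcup_(i in [set: 'I_n]) [set h | (rho (c i) h < eps%:E)%E]]].

(* Main.v *)
(* Coding words by itineraries: pulling q back through the sets V along a word
   u gives a point that f_u sends to q.  Under any other word of the same length
   the orbit of this point follows u up to the first letter applied at which the
   words differ, say j instead of i; there it lies in V i, hence outside U j, so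
   f j sends it into the invariant set A.  So the maps f_u are alpha-separated
   in the sup distance, and a ball of radius less than alpha / 2 contains at
   most one of them. *)
Require Import Defs.
From HB Require Import structures.
From mathcomp Require Import all_boot all_order all_algebra.
From mathcomp Require Import all_classical reals ereal topology.

Set Implicit Arguments.
Unset Strict Implicit.
Unset Printing Implicit Defensive.

Import Order.TTheory GRing.Theory Num.Theory.

Local Open Scope classical_set_scope.
Local Open Scope ring_scope.

(** Induction on [s], whose head is the letter applied last: [y] is first pulled back to some [y']
    in [V i], and since [V i] lies in [Q] the induction hypothesis applies to [y']. *)
Lemma itinerary_point (T : Type) (I : eqType) (f : I -> T -> T)
    (U V : I -> set T) (A Q : set T) :
  (forall i j x, i != j -> V i x -> ~ U j x) ->
  (forall i, V i `<=` Q) ->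
  (forall i, Q `<=` f i @` V i) ->
  (forall i, f i @` (~` U i) `<=` A) ->
  (forall i, f i @` A `<=` A) ->
  forall (s : seq I) (y : T), Q y -> exists2 x, comp_seq (map f s) x = y &
    forall s', size s' = size s -> s' != s -> A (comp_seq (map f s') x).
Proof.
move=> VU VQ QfV fUA fAA; elim=> [|i s IHs] y Qy.
  by exists y => // -[].
have [y' Viy' fy'] := QfV i _ Qy.
have [x fsx other] := IHs _ (VQ _ _ Viy').
exists x => [|[|j s'] //= [szs']]; first by rewrite /= fsx.
(* If the tails differ, the tail of the other word already sends [x] into [A], and [f j] keeps it
   there. If they agree, [x] reaches [y'], which is in [V i] and so outside [U j]. *)
have [->|s's] := eqVneq s' s; last first.
  by move=> _; apply: (fAA j); exists (comp_seq (map f s') x) => //; exact: other.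
rewrite eqseq_cons eqxx andbT eq_sym => ij.
apply: (fUA j); exists y'; first exact: VU ij Viy'.
by rewrite -fsx.
Qed.

Lemma le_set_dist (R : realType) (X : metricType R) (U V : set X) (e : R) x y :
  (e%:E <= set_dist U V)%E -> U x -> V y -> e <= mdist x y.
Proof.
move=> eUV Ux Vy; rewrite -lee_fin; apply: le_trans eUV _.
by apply: ereal_inf_lbound; exists (x, y).
Qed.

Lemma mdist_lt_dsup (R : realType) (X : metricType R) (g h : X -> X) (e : R) x :
  (dsup g h < e%:E)%E -> mdist (g x) (h x) < e.
Proof.
by move=> ghe; rewrite -lte_fin; apply: le_lt_trans ghe; apply: ereal_sup_ubound; exists x.
Qed.

(** Pigeonhole: assigning to each [u] a ball that contains [g u] is injective, as no ball contains
    two of these points. *)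
Lemma covering_number_ge_card (R : realType) (T : Type) (E : set T)
    (rho : T -> T -> \bar R) (A : set T) (eps : R) (W : finType) (g : W -> T) :
  (forall u, A (g u)) ->
  (forall c u v, (rho c (g u) < eps%:E)%E -> (rho c (g v) < eps%:E)%E -> u = v) ->
  (#|W|%:R%:E <= covering_number E rho A eps)%E.
Proof.
move=> Ag sep; apply/ereal_infP => _ [n [c [_ Ac]] <-].
rewrite lee_fin ler_nat.
have /choice[p pP] u : exists i, (rho (c i) (g u) < eps%:E)%E.
  by have [i _ ?] := Ac _ (Ag u); exists i.
rewrite -[n in (_ <= n)%N]card_ord; apply: (leq_card p) => u v puv.
by apply: sep (pP u) _; rewrite puv; exact: pP.
Qed.

Theorem mainTheorem8 (R : realType) (X : metricType R) (r : nat)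
    (f : 'I_r -> X -> X) (U V : 'I_r -> set X) (a : 'I_r -> X) (q : X)
    (Delta alpha : R) :
  let F := range f in
  let A := range a in
  let Q := q |` \bigcup_(j in [set: 'I_r]) V j in
  (2 <= r)%N ->
  (forall i, continuous (f i)) ->
  (forall i, V i !=set0 /\ V i `<=` U i) ->
  0 < Delta -> 0 < alpha ->
  (forall i j, i != j -> (Delta%:E <= set_dist (U i) (U j))%E) ->
  (forall i, Q `<=` f i @` V i) ->
  (forall i, f i @` (~` U i) = [set a i] /\ f i @` A `<=` A) ->
  (alpha%:E <= set_dist [set q] A)%E ->
  (forall (k : nat) (eps : R), 0 < eps -> eps < alpha / 2 ->
     ((r ^ k)%:R%:E <=
        covering_number (@cont_maps X) (@dsup R X) (compositions k F) eps)%E)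
  /\ (forall k : nat, injective (fun u : k.-tuple 'I_r => word_map f u)).
Proof.
move=> F A Q _ _ VU Delta0 alpha0 UU QfV fa qA.
have sep k (u v : k.-tuple 'I_r) : u != v ->
    exists x, alpha <= mdist (word_map f u x) (word_map f v x).
  move=> uv.
  have [| | | | |x ux vx] := @itinerary_point _ _ f U V A Q _ _ QfV _ _ u q.
  (* A common point of [U i] and [U j] would give [Delta <= 0]. *)
  - move=> i j x ij Vix Ujx.
    have := le_set_dist (UU _ _ ij) ((VU i).2 _ Vix) Ujx.
    by rewrite mdistxx leNgt Delta0.
  - by move=> i x Vix; right; exists i.
  - by move=> i; rewrite (fa i).1 => _ ->; exists i.
  - by move=> i; exact: (fa i).2.
  - by left.
  exists x; rewrite {1}/word_map ux; apply: (le_set_dist qA) => //.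
  by apply: vx; rewrite ?size_tuple // eq_sym.
split=> [k eps eps0 epsa|k u v uv].
  rewrite -[r in (r ^ k)%N]card_ord -card_tuple.
  apply: (@covering_number_ge_card _ _ _ _ _ _ _ (fun u : k.-tuple 'I_r => word_map f u)).
    move=> u; exists [seq f i | i <- u]; split=> //.
      by rewrite size_map size_tuple.
    by move=> _ /mapP[i _ ->]; exists i.
  (* The triangle inequality through [c x] is used at the separating point only, so it takes place
     in [X] and not for the extended-valued [dsup]. *)
  move=> c u v cu cv; apply/eqP/negP => /negP /sep[x]; apply/negP; rewrite -ltNge.
  rewrite (splitr alpha); apply: le_lt_trans (metric_triangle _ (c x) _) _.
  rewrite metric_sym; apply: ltrD; apply: lt_trans epsa; exact: mdist_lt_dsup.
apply/eqP/negP => /negP /sep[x]; rewrite [word_map f u]uv mdistxx.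
by rewrite leNgt alpha0.
Qed.
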